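(* Let $q\in\mathbb{N}$ and let $T$ be a $(q+1)$-homogeneous tree. For $1\leq p<\infty$, the differentiation operator $D$ is not an isometry on the Hardy space $\mathbb{T}_p(T)$.
   Context: A tree $T$ is a locally finite, connected, simply-connected graph, identified with its set of vertices, and rooted at a vertex $o$. It is $(q+1)$-homogeneous ($q\in\mathbb{N}=\{1,2,\dots\}$) if every vertex has exactly $q+1$ neighbors. For a vertex $v$, $|v|$ is the number of edges in the path from $o$ to $v$. For $v\neq o$, $v^-$ denotes the unique neighbor of $v$ lying on the path from $o$ to $v$ (the parent of $v$). The derivative of $f:T\to\mathbb{C}$ is $f'(v)=f(v)-f(v^-)$ for $v\neq o$ and $f'(o)=0$; the differentiation operator is $Df=f'$. For $1\leq p<\infty$, set $M_p(0,f)=|f(o)|$ and, for $n\in\mathbb{N}$, \[M_p(n,f)=\left(\frac{1}{(q+1)q^{n-1}}\sum_{|v|=n}|f(v)|^p\right)^{1/p}.\] The Hardy space $\mathbb{T}_p(T)$ is the set of all $f:T\to\mathbb{C}$ with $\|f\|_p=\sup_{n\in\mathbb{N}_0}M_p(n,f)<\infty$, where $\mathbb{N}_0=\mathbb{N}\cup\{0\}$; it is a Banach space under $\|\cdot\|_p$. $D$ is an isometry on $\mathbb{T}_p(T)$ if it maps $\mathbb{T}_p(T)$ into itself and $\|Df\|_p=\|f\|_p$ for all $f\in\mathbb{T}_p(T)$. *)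

(* Defs.v *)
From mathcomp Require Import all_boot all_order all_algebra.
From mathcomp Require Import all_classical all_reals all_analysis.
From mathcomp Require Export complex.

Set Implicit Arguments.
Unset Strict Implicit.
Unset Printing Implicit Defensive.

Import Order.TTheory GRing.Theory Num.Theory.

Local Open Scope classical_set_scope.
Local Open Scope card_scope.
Local Open Scope ring_scope.

Section Trees.
Variables (V : choiceType) (E : rel V).

Definition neighbors (v : V) : set V := [set w | E v w].

Definition locally_finite_graph : Prop := forall v, finite_set (neighbors v).

Definition connected_graph : Prop :=
  forall x y, exists2 s, path E x s & last x s = y.

(* In a symmetric graph every edge traversed back and forth is a [ucycle] of
   size 2, hence the size bound. *)
Definition acyclic_graph : Prop :=
  forall c : seq V, ucycle E c -> (size c <= 2)%N.

Record is_tree : Prop := IsTree {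
  tree_sym : symmetric E;
  tree_irr : irreflexive E;
  tree_locally_finite : locally_finite_graph;
  tree_connected : connected_graph;
  tree_acyclic : acyclic_graph }.

Definition homogeneous_graph (d : nat) : Prop :=
  forall v, neighbors v #= `I_d.

Definition simple_path (x y : V) (s : seq V) : Prop :=
  [/\ path E x s, uniq (x :: s) & last x s = y].

(* The path from [x] to [y] is [x :: tree_path x y], so [size (tree_path x y)]
   counts its edges. In a tree the simple path exists and is unique; the
   default value is never used. *)
Definition tree_path (x y : V) : seq V := xget [::] [set s | simple_path x y s].

Variable o : V.

Definition depth (v : V) : nat := size (tree_path o v).

Definition sphere (n : nat) : set V := [set v | depth v = n].

(* Meaningful for [v != o], where the neighbor of [v] on the path from [o] to
   [v] is unique. *)
Definition parent (v : V) : V :=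
  xget v [set u | E v u /\ u \in o :: tree_path o v].

Variable R : realType.

Definition differentiation (f : V -> R[i]) : V -> R[i] :=
  fun v => if v == o then 0 else f v - f (parent v).

Definition modulus (z : R[i]) : R := complex.Re `|z|.

(* In a locally finite tree the spheres are finite, so the finitely supported
   sum over [sphere n] is the ordinary finite sum. *)
Definition hardy_mean (q : nat) (p : R) (n : nat) (f : V -> R[i]) : R :=
  if n is m.+1 then
    (((q.+1 * q ^ m)%:R)^-1 * \sum_(v \in sphere n) modulus (f v) `^ p) `^ p^-1
  else modulus (f o).

Definition hardy_norm (q : nat) (p : R) (f : V -> R[i]) : \bar R :=
  ereal_sup (range (fun n => (hardy_mean q p n f)%:E)).

Definition hardy_space (q : nat) (p : R) : set (V -> R[i]) :=
  [set f | (hardy_norm q p f < +oo)%E].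

Definition hardy_isometry (q : nat) (p : R)
    (A : (V -> R[i]) -> (V -> R[i])) : Prop :=
  forall f, hardy_space q p f ->
    hardy_space q p (A f) /\ hardy_norm q p (A f) = hardy_norm q p f.

End Trees.

(* Main.v *)
Require Import Defs.
From mathcomp Require Import all_boot all_order all_algebra.
From mathcomp Require Import all_classical all_reals all_analysis.

(** The mean of a radial function over a sphere is the modulus of its value
    there, so a radial function that jumps next to the root by more than its
    own size has a derivative of larger norm.  Take [f] equal to 1 at the root [o], to -1 on the sphere
    of radius 1 and to 0 elsewhere.  Its means are at most 1, hence so is its
    norm, whereas [f v - f o = -2] for each [v] at distance 1 from [o], so the
    mean of the derivative over the sphere of radius 1 is 2
    ([hardy_mean_derivative_root_jump]).

    The tree enters only near the root: the sphere of radius 1 is the set of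
    neighbors of [o] ([sphere1E]), which has [q + 1] elements by homogeneity,
    and the parent of each of these is [o] ([parent_sphere1]).  Both come from
    the absence of cycles: a longer simple path from [o] to a neighbor would
    close up with the edge back to [o]. *)

Import Order.TTheory GRing.Theory Num.Theory.

Local Open Scope classical_set_scope.
Local Open Scope card_scope.
Local Open Scope ring_scope.

Section RootOfTree.
Variables (T : choiceType) (E : rel T) (o : T).
Hypothesis hT : is_tree E.

Lemma simple_path_self s : simple_path E o o s -> s = [::].
Proof.
case: s => [//|x s] [_ /= /andP[oNxs _] lasto].
by move: oNxs; rewrite -{1}lasto mem_last.
Qed.

Lemma simple_path_edge v : E o v -> simple_path E o v [:: v].
Proof.
move=> Eov; split=> //=; first by rewrite Eov.
rewrite andbT inE; apply/eqP => ov.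
by move: Eov; rewrite -ov (tree_irr hT).
Qed.

(** A simple path closed by the edge between its ends is a cycle without
    repetition, so acyclicity leaves no room for an intermediate vertex. *)
Lemma simple_path_to_neighbor v s :
  E o v -> simple_path E o v s -> s = [:: v].
Proof.
move=> Eov [Ps Us Ls].
have : (size (o :: s) <= 2)%N.
  apply: (tree_acyclic hT); rewrite /ucycle Us andbT /= rcons_path Ps Ls.
  by rewrite (tree_sym hT).
case: s {Ps Us} Ls => [/= ov|x [|//] /= -> //] _.
by move: Eov; rewrite -ov (tree_irr hT).
Qed.

Lemma tree_path_self : tree_path E o o = [::].
Proof.
rewrite /tree_path; case: xgetP => [s _|//]; exact: simple_path_self.
Qed.

Lemma tree_path_neighbor v : E o v -> tree_path E o v = [:: v].
Proof.
move=> Eov; rewrite /tree_path; case: xgetP => [s _|noPath].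
  exact: simple_path_to_neighbor.
by case: (noPath [:: v]); exact: simple_path_edge.
Qed.

Lemma depth_root : depth E o o = 0%N.
Proof. by rewrite /depth tree_path_self. Qed.

Lemma sphere1E : sphere E o 1 = neighbors E o.
Proof.
apply/seteqP; split=> v; rewrite /sphere /neighbors /depth /=; last first.
  by move=> /tree_path_neighbor ->.
(* The default value of [tree_path] is empty, so it cannot have size 1. *)
rewrite /tree_path; case: xgetP => [s _ [Ps _ Ls]|//].
by case: s Ps Ls => [//|x [|//]] /= /andP[Eox _] <-.
Qed.

Lemma parent_sphere1 v : sphere E o 1 v -> parent E o v = o.
Proof.
rewrite sphere1E => Eov.
rewrite /parent tree_path_neighbor //; case: xgetP => [u _ [Evu]|noParent].
  by rewrite !inE => /orP[/eqP//|/eqP uv]; rewrite uv (tree_irr hT) in Evu.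
by case: (noParent o); split; [rewrite (tree_sym hT)|rewrite inE eqxx].
Qed.

End RootOfTree.

Lemma modulus_real (R : realType) (x : R) : modulus (x%:C)%C = `|x|.
Proof. by rewrite /modulus normc_def /= expr0n addr0 sqrtr_sqr. Qed.

Lemma fsbig_const_card (R : realType) (T : choiceType) (A : set T) (d : nat)
  (c : R) : A #= `I_d -> \sum_(v \in A) c = c *+ d.
Proof.
move=> Ad; rewrite fsbig_finite /=; last by exists d.
by rewrite big_const_seq count_predT iter_addr_0 (card_fset_set Ad).
Qed.

Section RootJump.
Variables (R : realType) (T : choiceType) (E : rel T) (o : T).
Variables (q : nat) (p : R).
Hypotheses (hT : is_tree E) (hhom : homogeneous_graph E q.+1) (hp : 1 <= p).

Let p_neq0 : p != 0.
Proof. by rewrite gt_eqF // (lt_le_trans ltr01 hp). Qed.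

(** The normalization [(q + 1) q^0] is the number of terms, and the powers [p]
    and [p^-1] cancel on nonnegative reals. *)
Lemma hardy_mean1_const (f : T -> R[i]) (c : R) : 0 <= c ->
  {in sphere E o 1, forall v, modulus (f v) = c} ->
  hardy_mean E o q p 1 f = c.
Proof.
move=> c0 fc.
rewrite /hardy_mean (eq_fsbigr (fun=> c `^ p)); last by move=> v /fc ->.
rewrite (fsbig_const_card _ _ _ q.+1); last by rewrite sphere1E.
rewrite expn0 muln1 -(mulr_natl (c `^ p)) mulKf; last by rewrite pnatr_eq0.
by rewrite -powRrM mulfV // powRr1.
Qed.

Definition root_jump (v : T) : R[i] :=
  ((match depth E o v with 0 => 1 | 1 => -1 | _ => 0 end)%:C)%C.

Lemma hardy_mean_root_jump_le1 n : hardy_mean E o q p n root_jump <= 1.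
Proof.
case: n => [|[|n]].
- by rewrite /hardy_mean /root_jump depth_root modulus_real normr1.
- rewrite (hardy_mean1_const _ 1) // => v; rewrite inE /sphere /= => dv.
  by rewrite /root_jump dv modulus_real normrN1.
rewrite /hardy_mean fsbig1; last first.
  move=> v; rewrite /sphere /= => dv.
  by rewrite /root_jump dv modulus_real normr0 powR0.
by rewrite mulr0 powR0 ?invr_eq0.
Qed.

Lemma hardy_mean_derivative_root_jump :
  hardy_mean E o q p 1 (differentiation E o root_jump) = 2.
Proof.
apply: hardy_mean1_const => // v; rewrite inE => v1.
have dv : depth E o v = 1%N by exact: v1.
have vNo : v == o = false.
  by apply/eqP => vo; move: dv; rewrite vo depth_root.
rewrite /differentiation vNo parent_sphere1 // /root_jump dv depth_root.
by rewrite -rmorphB modulus_real -opprD normrN ger0_norm.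
Qed.

Lemma hardy_norm_root_jump_le1 : (hardy_norm E o q p root_jump <= 1)%E.
Proof.
apply: ge_ereal_sup => _ [n _ <-].
by rewrite lee_fin hardy_mean_root_jump_le1.
Qed.

End RootJump.

Theorem corollary5p3 (R : realType) (q : nat) (hq : (1 <= q)%N)
    (T : choiceType) (E : rel T) (o : T)
    (hT : is_tree E) (hhom : homogeneous_graph E q.+1)
    (p : R) (hp : 1 <= p) :
  ~ hardy_isometry E o q p (differentiation E o (R := R)).
Proof.
have norm_le1 := hardy_norm_root_jump_le1 _ _ _ o _ _ hT hhom hp.
move=> /(_ _ (le_lt_trans norm_le1 (ltry 1)))[_ isom].
have : (2%:E <= hardy_norm E o q p (differentiation E o (root_jump R T E o)))%E.
  apply: ereal_sup_ubound; exists 1%N; first by [].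
  by rewrite hardy_mean_derivative_root_jump.
by rewrite isom => /le_trans/(_ norm_le1); rewrite lee_fin leNgt ltr1n.
Qed.
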